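(* Let $\mathscr I$ be an ideal on a countable set. Then: (1) $\operatorname{add}(M_{\mathscr I})=\operatorname{add}(K_{\mathscr I})=\min\{\mathfrak b,\operatorname{add}^*_\omega(\mathscr I)\}$. (2) $\mathfrak b\le\operatorname{non}(K_{\mathscr I})\le\operatorname{non}(M_{\mathscr I})\le\max\{\mathfrak b,\operatorname{non}^*_\omega(\mathscr I)\}$. (3) $\min\{\mathfrak d,\operatorname{cov}^*(\mathscr I)\}\le\operatorname{cov}(M_{\mathscr I})\le\operatorname{cov}(K_{\mathscr I})\le\mathfrak d$. (4) $\operatorname{cof}(M_{\mathscr I})=\operatorname{cof}(K_{\mathscr I})=\max\{\mathfrak d,\operatorname{cof}^*_\omega(\mathscr I)\}$.
   Context: An ideal $\mathscr I$ on a countable (infinite) set $X$ is a family of subsets of $X$ closed under subsets and finite unions; it is always assumed that $X\notin\mathscr I$ and that $\mathscr I$ contains all finite subsets of $X$. $\mathfrak b,\mathfrak d$ are the bounding and dominating numbers of $(\omega^\omega,\le^* )$. $M_{\mathscr I}$ is the $\sigma$-ideal on $X^\omega$ generated by the sets $M_\phi=\{x\in X^\omega:\forall^\infty n<\omega\ x(n)\in\phi(x\upharpoonright n)\}$ for $\phi\colon X^{<\omega}\to\mathscr I$. $K_{\mathscr I}$ is the $\sigma$-ideal on $X^\omega$ generated by the sets $K_\phi=\{x\in X^\omega:\forall^\infty n<\omega\ x(n)\in\phi(n)\}$ for $\phi\colon\omega\to\mathscr I$. ($\forall^\infty n$ means ''for all but finitely many $n$''.) For a $\sigma$-ideal $\mathcal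 I$ on a set $Y$: $\operatorname{add}(\mathcal I)$ is the least size of $\mathcal A\subseteq\mathcal I$ with $\bigcup\mathcal A\notin\mathcal I$; $\operatorname{non}(\mathcal I)$ is the least size of a subset of $Y$ not in $\mathcal I$; $\operatorname{cov}(\mathcal I)$ is the least size of $\mathcal A\subseteq\mathcal I$ with $\bigcup\mathcal A=Y$; $\operatorname{cof}(\mathcal I)$ is the least size of $\mathcal A\subseteq\mathcal I$ such that every $B\in\mathcal I$ is a subset of some $A\in\mathcal A$. For the ideal $\mathscr I$ on the countable set $X$ ($\subseteq^*$ is inclusion modulo a finite set; $[Y]^\omega$ is the set of countably infinite subsets of $Y$): $\operatorname{add}^*_\omega(\mathscr I)=\min\{|\mathcal A|:\mathcal A\subseteq\mathscr I,\ \forall\overline B\in[\mathscr I]^\omega\,\exists A\in\mathcal A\,\forall B\in\overline B\ A\not\subseteq^*B\}$ (set to be $\infty$ if no such $\mathcal A$ exists); $\operatorname{non}^*_\omega(\mathscr I)=\min\{|\mathcal A|:\mathcal A\subseteq[X]^\omega,\ \forall\overline B\in[\mathscr I]^\omega\,\exists A\in\mathcal A\,\forall B\in\overline B\ |A\cap B|<\omega\}$; $\operatorname{cov}^*(\mathscr I)=\min\{|\mathcal A|:\mathcal A\subseteq\mathscr I,\ \forall B\in[X]^\omega\,\exists A\in\mathcal A\ |A\cap B|=\omega\}$ (set to be $\infty$ if no such $\mathcal A$ exists); $\operatorname{cof}^*_\omega(\mathscr I)=\min\{|\mathcal A|:\mathcal A\subseteq[\mathscr I]^\omega,\ \forall\overline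 B\in[\mathscr I]^\omega\,\exists\overline A\in\mathcal A\,\forall B\in\overline B\,\exists A\in\overline A\ B\subseteq^*A\}$. *)

(* Defs.v *)
From mathcomp Require Import all_boot.
From mathcomp Require Import all_classical.

Set Implicit Arguments.
Unset Strict Implicit.
Unset Printing Implicit Defensive.

Local Open Scope classical_set_scope.
Local Open Scope card_scope.

(* Cardinals, extended by a largest element [Infty]. A cardinal is represented
   by any set of that cardinality, so that equality of cardinals is [=c]
   (equipotence) and not Leibniz equality. *)
Inductive xcard : Type :=
| Size (T : Type) (A : set T)
| Infty.

Definition xcard_le (k l : xcard) : Prop :=
  match k, l with
  | _, Infty => True
  | Infty, Size _ _ => False
  | Size T A, Size U B => A #<= B
  end.

Definition xcard_eq (k l : xcard) : Prop :=
  match k, l with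
  | Infty, Infty => True
  | Size T A, Size U B => A #= B
  | _, _ => False
  end.

Notation "k <=c l" := (xcard_le k l) (at level 70, no associativity).
Notation "k =c l" := (xcard_eq k l) (at level 70, no associativity).

(* Well-foundedness of cardinals: a maximal set of choice functions for [P]
   that are pairwise distinct at every member of [P] is mapped onto some member
   of [P] by evaluation, and injectively into each of them. *)
Lemma least_size_ex (T : Type) (P : set (set T)) : P !=set0 ->
  exists A, P A /\ forall B, P B -> A #<= B.
Proof.
move=> [A0 PA0].
pose good (W : set (set T -> T)) :=
  (forall g A, W g -> P A -> A (g A)) /\
  (forall g h A, W g -> W h -> P A -> g A = h A -> g = h).
have [F Fgood totF|W [[W1 W2] Wmax]] := @Zorn_bigcup _ good.
  split=> [g A [V FV Vg] PA|g h A [V FV Vg] [V' FV' V'h] PA gh].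
    by have [G1 _] := Fgood _ FV; exact: (G1 g A).
  have [VV'|V'V] := totF _ _ FV FV'.
    by have [_ G2] := Fgood _ FV'; exact: (G2 g h A (VV' _ Vg)).
  by have [_ G2] := Fgood _ FV; exact: (G2 g h A Vg (V'V _ V'h)).
have [[A [PA AW]]|noA] := pselect (exists A, P A /\
    forall a, A a -> exists2 g, W g & g A = a).
  exists A; split=> // B PB.
  apply: (@card_le_trans _ _ _ W).
    apply: (@card_le_trans _ _ _ ((fun g => g A) @` W)).
      by apply: subset_card_le => a /AW[g Wg <-]; exists g.
    exact: card_image_le.
  have injW : {in W &, injective (fun g : set T -> T => g B)}.
    by move=> g h /set_mem Wg /set_mem Wh; exact: (W2 g h B).
  apply: (@card_le_trans _ _ _ ((fun g => g B) @` W)).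
    have /card_esym : ((fun g => g B) @` W) #= W by exact: inj_card_eq.
    by move=> /card_eqPle[].
  by apply: subset_card_le => _ [g Wg <-]; exact: (W1 g B).
exfalso.
have ex A : P A -> exists a, A a /\ forall g, W g -> g A <> a.
  move=> PA; apply: contrapT => nex; apply: noA; exists A; split=> // a Aa.
  apply: contrapT => ng; apply: nex; exists a; split=> // g Wg gA.
  by apply: ng; exists g.
have [a0 _] := ex _ PA0.
have /choice[g0 g0P] : forall A, exists a,
    P A -> A a /\ forall g, W g -> g A <> a.
  move=> A; have [/ex[a aP]|nPA] := pselect (P A); first by exists a.
  by exists a0.
apply: (Wmax (W `|` [set g0])).
  split; first exact: subsetUl.
  move=> /(_ g0 (or_intror erefl)) Wg0.
  by have [_ /(_ _ Wg0)] := g0P _ PA0.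
split=> [g A [Wg|->] PA|g h A [Wg|->] [Wh|->] PA gh //].
- exact: (W1 g A).
- by have [] := g0P _ PA.
- exact: (W2 _ _ A).
- by have [_ /(_ _ Wg)] := g0P _ PA.
- by have [_ /(_ _ Wh)] := g0P _ PA; rewrite gh.
Qed.

Lemma card_le_total (T U : Type) (A : set T) (B : set U) :
  A #<= B \/ B #<= A.
Proof.
pose P : set (set (T + U)) := [set inl @` A; inr @` B].
have cA : (@inl T U @` A) #= A by apply: inj_card_eq => x y _ _ [].
have cB : (@inr T U @` B) #= B by apply: inj_card_eq => x y _ _ [].
have [|C [[->|->] Cmin]] := @least_size_ex _ P; first by exists (inl @` A); left.
- by left; rewrite -(card_le_eql cA) -(card_le_eqr cB); apply: Cmin; right.
- by right; rewrite -(card_le_eql cB) -(card_le_eqr cA); apply: Cmin; left.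
Qed.

Lemma xcard_le_total (k l : xcard) : k <=c l \/ l <=c k.
Proof.
by case: k l => [T A|] [U B|] /=; [exact: card_le_total|left|right|left].
Qed.

Definition xcard_min (k l : xcard) : xcard := if `[< k <=c l >] then k else l.
Definition xcard_max (k l : xcard) : xcard := if `[< k <=c l >] then l else k.

(* min {|A| : A in P}, and [Infty] if [P] is empty. *)
Definition least_size (T : Type) (P : set (set T)) : xcard :=
  match pselect (P !=set0) with
  | left P0 => Size (projT1 (cid (least_size_ex P0)))
  | right _ => Infty
  end.

Definition eventually_leq (f g : nat -> nat) : Prop :=
  \forall n \near \oo, (f n <= g n)%N.

Notation "f <=* g" := (eventually_leq f g) (at level 70, no associativity).

Definition bounding : xcard :=
  least_size [set F : set (nat -> nat) |
    ~ exists g, forall f, F f -> f <=* g].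

Definition dominating : xcard :=
  least_size [set F : set (nat -> nat) |
    forall g, exists2 f, F f & g <=* f].

Section SigmaIdeals.
Variable Y : Type.
Implicit Types J : set (set Y).

Definition sigma_ideal J : Prop :=
  [/\ J set0,
      (forall A B, A `<=` B -> J B -> J A) &
      (forall F : nat -> set Y, (forall n, J (F n)) -> J (\bigcup_n F n))].

Definition add J : xcard :=
  least_size [set A : set (set Y) | A `<=` J /\ ~ J (\bigcup_(B in A) B)].

Definition non J : xcard :=
  least_size [set A : set Y | ~ J A].

Definition cov J : xcard :=
  least_size [set A : set (set Y) |
    A `<=` J /\ \bigcup_(B in A) B = [set: Y]].

Definition cof J : xcard :=
  least_size [set A : set (set Y) |
    A `<=` J /\ forall B, J B -> exists2 C, A C & B `<=` C].

End SigmaIdeals.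

Section Ideals.
Variable X : Type.
Implicit Types I : set (set X).

Definition ideal I : Prop :=
  [/\ (forall A B, A `<=` B -> I B -> I A),
      (forall A B, I A -> I B -> I (A `|` B)),
      ~ I [set: X] &
      (forall A, finite_set A -> I A)].

Definition M_set (phi : seq X -> set X) : set (nat -> X) :=
  [set x | \forall n \near \oo, phi (mkseq x n) (x n)].

Definition M_ideal I : set (set (nat -> X)) :=
  smallest (@sigma_ideal (nat -> X))
    [set M_set phi | phi in [set phi | forall s, I (phi s)]].

Definition K_set (phi : nat -> set X) : set (nat -> X) :=
  [set x | \forall n \near \oo, phi n (x n)].

Definition K_ideal I : set (set (nat -> X)) :=
  smallest (@sigma_ideal (nat -> X))
    [set K_set phi | phi in [set phi | forall n, I (phi n)]].

Definition almost_subset (A B : set X) : Prop := finite_set (A `\` B).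

End Ideals.

Notation "A `<=*` B" := (almost_subset A B) (at level 70, no associativity).

(* [Y]^omega, the countably infinite subsets of Y *)
Definition omega_subsets (T : Type) (Y : set T) : set (set T) :=
  [set B | B `<=` Y /\ B #= [set: nat]].

Section StarInvariants.
Variable X : Type.
Implicit Types I : set (set X).

Definition add_star_omega I : xcard :=
  least_size [set A : set (set X) | A `<=` I /\
    forall Bs, omega_subsets I Bs ->
      exists2 C, A C & forall B, Bs B -> ~ (C `<=*` B)].

Definition non_star_omega I : xcard :=
  least_size [set A : set (set X) | A `<=` omega_subsets [set: X] /\
    forall Bs, omega_subsets I Bs ->
      exists2 C, A C & forall B, Bs B -> finite_set (C `&` B)].

Definition cov_star I : xcard :=
  least_size [set A : set (set X) | A `<=` I /\
    forall B, omega_subsets [set: X] B ->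
      exists2 C, A C & C `&` B #= [set: nat]].

Definition cof_star_omega I : xcard :=
  least_size [set A : set (set (set X)) | A `<=` omega_subsets I /\
    forall Bs, omega_subsets I Bs ->
      exists2 As, A As & forall B, Bs B -> exists2 C, As C & B `<=*` C].

End StarInvariants.

(* Main.v *)
(* Order I^omega by [phi <=* psi] iff [phi n] is included in [psi n] for almost
   all n. The sets in M_I and K_I are those contained in a single generator, and
   both (M_I, inclusion) and (K_I, inclusion) are Tukey equivalent to I^omega:
   if K_phi is included in M_psi, where all [phi n] share a point x0, then for
   some finite sequence s the set [phi n] is included in [psi t] for every
   extension t of s by copies of x0, n being the length of t. The least
   unbounded and dominating families of I^omega are then computed in two steps:
   first trap every [phi n] in a member of a countable increasing family, then
   bound or dominate the indices of these members. For non(M_I) and cov(M_I) one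
   restricts to sequences taking their values in infinite sets that meet each
   value of phi in a finite set; M_phi then becomes a countable union of bodies
   of finitely branching trees, hence is bounded in omega^omega. *)
Require Import Defs.
From mathcomp Require Import all_boot.
From mathcomp Require Import all_classical.

Set Implicit Arguments.
Unset Strict Implicit.
Unset Printing Implicit Defensive.

Local Open Scope classical_set_scope.
Local Open Scope card_scope.

(** * Eventual statements, and comparison of cardinals through injections *)

Lemma near_ooP (P : nat -> Prop) :
  (\forall n \near \oo, P n) <-> exists N, forall n, (N <= n)%N -> P n.
Proof.
split=> [[N _ NP]|[N NP]]; first by exists N => n /NP.
by exists N => // n /NP.
Qed.

Lemma card_le_injective T U (A : set T) (B : set U) (f : T -> U) :
  (forall x, A x -> B (f x)) ->
  (forall x y, A x -> A y -> f x = f y -> x = y) -> A #<= B.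
Proof.
move=> fAB finj.
have /card_esym : f @` A #= A.
  by apply: inj_card_eq => x y /set_mem Ax /set_mem Ay; exact: finj.
move=> /card_eqPle[cA _]; apply: card_le_trans cA _.
by apply: subset_card_le => _ [x Ax <-]; exact: fAB.
Qed.

Lemma card_le_ex_injective T U (u0 : U) (A : set T) (B : set U) : A #<= B ->
  exists f : T -> U, (forall x, A x -> B (f x)) /\
    (forall x y, A x -> A y -> f x = f y -> x = y).
Proof.
move=> /card_leP[f].
pose g x := if pselect (A x) is left Ax then set_val (f (SigSub (mem_set Ax)))
            else u0.
exists g; split=> [x Ax|x y Ax Ay]; rewrite /g.
  by case: pselect => // {}Ax; exact/set_mem/valP.
case: pselect => // {}Ax; case: pselect => // {}Ay /val_inj fxy.
by have [] := @inj _ _ _ f _ _ (in_setT _) (in_setT _) fxy.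
Qed.

Lemma card_le_fun_nat T (t0 : T) (A : set T) : infinite_set A ->
  exists2 u : nat -> T, (forall n, A (u n)) & injective u.
Proof.
move=> /infiniteP/(card_le_ex_injective t0)[u [uA uinj]].
by exists u => [n|m n]; [exact: uA|exact: uinj].
Qed.

(** * Infinite cardinals are equal to their squares *)

Section Hessenberg.
Variables (T : Type) (A : set T) (u : nat -> T).
Hypotheses (uA : forall n, A (u n)) (u_inj : injective u).
Implicit Types G : set (T * T * T).

Let fld G : set T := [set x | exists y, G (x, x, y)].

(* [G] need not be functional: choice extracts from it an injection of the
   square of [fld G] into [fld G]. *)
Let squaring G :=
  [/\ forall n, fld G (u n), fld G `<=` A,
      forall x y, fld G x -> fld G y -> exists z, G (x, y, z),
      forall p z, G (p, z) -> fld G z &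
      forall p q z, G (p, z) -> G (q, z) -> p = q].

Let squaring_nat : squaring
  [set t | exists m n, t = (u m, u n, u (pickle (m, n)))].
Proof.
have fldE x : fld [set t | exists m n, t = (u m, u n, u (pickle (m, n)))] x
    <-> exists n, x = u n.
  split=> [[y [m [n []]]]|[n ->]]; first by exists m.
  by exists (u (pickle (n, n))), n, n.
split=> [n|x /fldE[n ->] //|x y /fldE[m ->] /fldE[n ->]|p z|p q z].
- by apply/fldE; exists n.
- by exists (u (pickle (m, n))), m, n.
- by move=> [m [n [_ ->]]]; apply/fldE; exists (pickle (m, n)).
- move=> [m [n [-> ->]]] [m' [n' [->]]] /u_inj.
  by move=> /(pcan_inj (@pickleK _))[-> ->].
Qed.

Let squaring_card G : squaring G ->
  exists2 f : T -> T -> T, (forall x y, fld G x -> fld G y -> fld G (f x y)) &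
   (forall x y x' y', fld G x -> fld G y -> fld G x' -> fld G y' ->
    f x y = f x' y' -> x = x' /\ y = y').
Proof.
move=> [_ _ Gtot Gfld Ginj].
have /choice[f fP] p : exists z, fld G p.1 -> fld G p.2 -> G (p, z).
  have [[p1 p2]|np] := pselect (fld G p.1 /\ fld G p.2).
    by have [z] := Gtot _ _ p1 p2; rewrite -surjective_pairing; exists z.
  by exists (u 0) => p1 p2; case: np.
exists (fun x y => f (x, y)) => [x y Gx Gy|x y x' y' Gx Gy Gx' Gy' fE].
  exact/Gfld/(fP (x, y)).
have := Ginj _ _ _ (fP (x, y) Gx Gy).
by rewrite fE => /(_ _ (fP (x', y') Gx' Gy'))[-> ->].
Qed.

(* With [B := fld G] and [c] an injection of [B] into [A `\` B], each of the
   three new blocks of the square of [B `|` c @` B] is a copy of [B `*` B], and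
   the three are sent to disjoint parts of [c @` B]. *)
Let squaring_extension G : squaring G -> fld G #<= A `\` fld G ->
  exists2 H, squaring H & G `<` H.
Proof.
move=> sG; have [f fG f_inj] := squaring_card sG.
move=> /(card_le_ex_injective (u 0))[c [cG c_inj]].
have [Gu GA Gtot Gfld Ginj] := sG.
pose e (i : bool) x := if i then x else c x.
(* The block [(i, j)] is recorded by the point [u (pickle (i, j))] of [fld G], which keeps the
   images of the three new blocks disjoint. *)
pose v x y i j := f (f x y) (u (pickle (i : bool, j : bool))).
pose N : set (T * T * T) := [set t | exists i j x y,
  [/\ ~~ (i && j), fld G x, fld G y & t = (e i x, e j y, c (v x y i j))]].
have e_inj i j x y : fld G x -> fld G y -> e i x = e j y -> i = j /\ x = y.
  move=> Gx Gy; case: i j => [] [] /=; rewrite /e => exy.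
  - by [].
  - by have [_ []] := cG _ Gy; rewrite -exy.
  - by have [_ []] := cG _ Gx; rewrite exy.
  - by split=> //; exact: c_inj exy.
have v_fld x y i j : fld G x -> fld G y -> fld G (v x y i j).
  by move=> Gx Gy; apply: (fG _ _ (fG _ _ Gx Gy)).
have v_inj x y i j x' y' i' j' : fld G x -> fld G y -> fld G x' -> fld G y' ->
    v x y i j = v x' y' i' j' -> [/\ x = x', y = y', i = i' & j = j'].
  move=> Gx Gy Gx' Gy' vE.
  have [fE /u_inj/(pcan_inj (@pickleK _))[-> ->]] :=
    f_inj _ _ _ _ (fG _ _ Gx Gy) (Gu _) (fG _ _ Gx' Gy') (Gu _) vE.
  by have [-> ->] := f_inj _ _ _ _ Gx Gy Gx' Gy' fE.
pose E z := exists i x, fld G x /\ z = e i x.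
have fldE z : fld (G `|` N) z <-> E z.
  split=> [[y [Gy|[i [j [x [x' [_ Gx _ [-> _ _]]]]]]]]|[[] [x [Gx ->]]]].
  - by exists true, z; split=> //; exists y.
  - by exists i, x.
  - by have [y Gy] := Gx; exists y; left.
  - by exists (c (v x x false false)); right; exists false, false, x, x.
exists (G `|` N).
  split.
  - by move=> n; apply/fldE; exists true, (u n).
  - by move=> x /fldE[[] [y [Gy ->]]]; [exact: GA|have [] := cG _ Gy].
  - move=> _ _ /fldE[i [x [Gx ->]]] /fldE[j [y [Gy ->]]].
    have [/andP[-> ->]|nij] := boolP (i && j).
      by have [z Gz] := Gtot _ _ Gx Gy; exists z; left.
    by exists (c (v x y i j)); right; exists i, j, x, y.
  - move=> p z [/Gfld Gz|[i [j [x [y [_ Gx Gy [_ ->]]]]]]]; apply/fldE.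
      by exists true, z.
    by exists false, (v x y i j); split=> //; exact: v_fld.
  - move=> p q z [Gp|[i [j [x [y [_ Gx Gy [-> ->]]]]]]]
           [Gq|[i' [j' [x' [y' [_ Gx' Gy' [-> zE]]]]]]].
    + exact: Ginj Gp Gq.
    + have /cG[_ []] := v_fld _ _ i' j' Gx' Gy'.
      by rewrite -zE; exact: Gfld Gp.
    + have /cG[_ []] := v_fld _ _ i j Gx Gy.
      exact: Gfld Gq.
    + have vE := c_inj _ _ (v_fld _ _ _ _ Gx Gy) (v_fld _ _ _ _ Gx' Gy') zE.
      by have [-> -> -> ->] := v_inj _ _ _ _ _ _ _ _ Gx Gy Gx' Gy' vE.
split; first by move=> t; left.
(* If nothing were gained, [c (u 0)] would lie in [fld G], against the choice of [c]. *)
move=> HG; have /cG[_] := Gu 0; apply.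
exists (c (v (u 0) (u 0) false false)); apply: HG; right.
by exists false, false, (u 0), (u 0).
Qed.

(** Zorn's lemma gives a maximal squaring graph [G]. By [squaring_extension], [fld G] does not
    inject into its complement in [A], so this complement injects into [fld G]. Two disjoint copies
    inside [fld G] then absorb all of [A], and a pairing on [fld G] finishes. *)
Lemma card_setX_le_inj : A `*` A #<= A.
Proof.
pose P G := G = set0 \/ squaring G.
have [F FP totF|G [[G0|sG] Gmax]] := @Zorn_bigcup _ P.
- have [[G [FG sG]]|nG] := pselect (exists G, F G /\ squaring G); last first.
    left; rewrite -subset0 => t [G FG Gt].
    by have [G0|sG] := FP _ FG; [rewrite G0 in Gt|apply: nG; exists G].
  right.
  have fldU x : fld (\bigcup_(H in F) H) x <-> exists2 H, F H & fld H x.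
    split=> [[y [H FH Hy]]|[H FH [y Hy]]]; first by exists H => //; exists y.
    by exists y, H.
  have sq H t : F H -> H t -> squaring H.
    by move=> FH Ht; have [H0|//] := FP _ FH; rewrite H0 in Ht.
  have sqU H K : F H -> F K -> exists L, [/\ F L, H `<=` L & K `<=` L].
    move=> FH FK; have [HK|KH] := totF _ _ FH FK.
      by exists K; split=> // ? /HK.
    by exists H; split=> // ? /KH.
  split.
  + by move=> n; apply/fldU; exists G => //; have [] := sG.
  + move=> x /fldU[H FH [y Hy]]; have [_ HA _ _ _] := sq _ _ FH Hy.
    by apply: HA; exists y.
  + move=> x y /fldU[H FH [x' Hx]] /fldU[K FK [y' Ky]].
    have [L [FL HL KL]] := sqU _ _ FH FK.
    have [_ _ Ltot _ _] := sq _ _ FL (HL _ Hx).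
    have [||z Lz] := Ltot x y; [by exists x'; exact: HL|by exists y'; exact: KL|].
    by exists z, L.
  + move=> p z [H FH Hz]; have [_ _ _ Hfld _] := sq _ _ FH Hz.
    by apply/fldU; exists H => //; exact: Hfld Hz.
  + move=> p q z [H FH Hp] [K FK Kq].
    have [L [FL HL KL]] := sqU _ _ FH FK.
    have [_ _ _ _ Linj] := sq _ _ FL (HL _ Hp).
    exact: Linj (HL _ Hp) (KL _ Kq).
- exfalso; apply: (Gmax _ _ (or_intror squaring_nat)).
  rewrite G0; split; first exact: sub0set.
  by move=> /(_ (u 0, u 0, u (pickle (0, 0)))); apply; exists 0, 0.
have [GG|] := card_le_total (fld G) (A `\` fld G).
  by have [H sH GH] := squaring_extension sG GG; case: (Gmax H GH); right.
move=> /(card_le_ex_injective (u 0))[k [kG k_inj]].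
have [Gu GA _ _ _] := sG; have [f fG f_inj] := squaring_card sG.
(* The tags [u 0] and [u 1] separate the image of [fld G] from that of its complement. *)
pose g x := if pselect (fld G x) then f x (u 0) else f (k x) (u 1).
have gG x : A x -> fld G (g x).
  rewrite /g; case: pselect => [Gx _|nGx Ax]; first exact: fG.
  by apply: (fG _ _ _ (Gu _)); exact: kG.
have g_inj x y : A x -> A y -> g x = g y -> x = y.
  move=> Ax Ay; rewrite /g.
  case: pselect => Gx; case: pselect => Gy fE.
  - by have [] := f_inj _ _ _ _ Gx (Gu _) Gy (Gu _) fE.
  - by have [_ /u_inj] := f_inj _ _ _ _ Gx (Gu _) (kG y (conj Ay Gy)) (Gu _) fE.
  - by have [_ /u_inj] := f_inj _ _ _ _ (kG x (conj Ax Gx)) (Gu _) Gy (Gu _) fE.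
  - have [kE _] := f_inj _ _ _ _ (kG x (conj Ax Gx)) (Gu _)
      (kG y (conj Ay Gy)) (Gu _) fE.
    exact: k_inj kE.
apply: (@card_le_injective _ _ _ _ (fun p => f (g p.1) (g p.2))).
  by move=> [x y] [Ax Ay]; apply/GA/fG; exact: gG.
move=> [x y] [x' y'] [/= Ax Ay] [/= Ax' Ay'] fE.
have [gE gE'] := f_inj _ _ _ _ (gG _ Ax) (gG _ Ay) (gG _ Ax') (gG _ Ay') fE.
by rewrite (g_inj _ _ Ax Ax' gE) (g_inj _ _ Ay Ay' gE').
Qed.

End Hessenberg.

Lemma card_setX_le T U (A : set T) (B : set U) :
  infinite_set B -> A #<= B -> A `*` B #<= B.
Proof.
move=> Binf AB.
have [b0 _] := infinite_setN0 Binf.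
have [u uB u_inj] := card_le_fun_nat b0 Binf.
have [f [fB f_inj]] := card_le_ex_injective b0 AB.
apply: card_le_trans (card_setX_le_inj uB u_inj).
apply: (@card_le_injective _ _ _ _ (fun p => (f p.1, p.2))).
  by move=> [x y] [Ax By]; split=> //; exact: fB.
by move=> [x y] [x' y'] [/= Ax _] [/= Ax' _] [/f_inj-> // ->].
Qed.

(** * Least sizes and Tukey connections *)

Lemma xcard_le_refl k : k <=c k.
Proof. by case: k => //= T A; exact: card_lexx. Qed.

Lemma xcard_le_Infty k : k <=c Infty.
Proof. by case: k. Qed.

Lemma xcard_le_trans k l m : k <=c l -> l <=c m -> k <=c m.
Proof.
by case: k l m => [T A|] [U B|] [V C|] //=; exact: card_le_trans.
Qed.

Lemma xcard_le_anti k l : k <=c l -> l <=c k -> k =c l.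
Proof. by case: k l => [T A|] [U B|] //= *; apply/card_eqPle. Qed.

Lemma xcard_image_le T U (f : T -> U) (A : set T) : Size (f @` A) <=c Size A.
Proof. exact: card_image_le. Qed.

Lemma xcard_min_le k l m : k <=c m \/ l <=c m -> xcard_min k l <=c m.
Proof.
rewrite /xcard_min; case: asboolP => kl [] // => [|km].
  exact: xcard_le_trans.
by have [//|lk] := xcard_le_total k l; exact: xcard_le_trans km.
Qed.

Lemma xcard_le_min k l m : k <=c l -> k <=c m -> k <=c xcard_min l m.
Proof. by rewrite /xcard_min; case: ifP. Qed.

Lemma xcard_le_maxl k l : k <=c xcard_max k l.
Proof. by rewrite /xcard_max; case: asboolP => // _; exact: xcard_le_refl. Qed.

Lemma xcard_le_maxr k l : l <=c xcard_max k l.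
Proof.
rewrite /xcard_max; case: asboolP => kl; first exact: xcard_le_refl.
by case: (xcard_le_total k l).
Qed.

Lemma xcard_max_le k l m : k <=c m -> l <=c m -> xcard_max k l <=c m.
Proof. by rewrite /xcard_max; case: ifP. Qed.

(** Whichever factor is larger is infinite, so it absorbs the product. This bounds families indexed
    by pairs, with an unbounded or dominating family as [A]. *)
Lemma xcard_max_setX T U (A : set T) (B : set U) : infinite_set A ->
  Size (A `*` B) <=c xcard_max (Size A) (Size B).
Proof.
move=> Ainf; rewrite /xcard_max; case: asboolP => /= AB.
  apply: card_setX_le => // Bfin; apply: Ainf.
  exact: card_le_finite AB Bfin.
have BA : B #<= A by have [] := card_le_total A B.
apply: card_le_trans (card_setX_le Ainf BA).
by apply: (@card_le_injective _ _ _ _ (fun p => (p.2, p.1)));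
  [move=> [x y] []|move=> [x y] [x' y'] _ _ [-> ->]].
Qed.

Lemma least_size_le T (P : set (set T)) A : P A -> least_size P <=c Size A.
Proof.
rewrite /least_size; case: pselect => [P0 PA|nP PA]; last by case: nP; exists A.
by case: cid => /= B [_]; exact.
Qed.

Variant least_size_spec T (P : set (set T)) : xcard -> Prop :=
| LeastSize A of P A : least_size_spec P (Size A)
| LeastInfty : least_size_spec P Infty.

Lemma least_sizeP T (P : set (set T)) : least_size_spec P (least_size P).
Proof.
rewrite /least_size; case: pselect => [P0|_]; last by constructor.
by case: cid => /= B [PB _]; constructor.
Qed.

(** The two norms of a relational system with challenges in [D] and responses in [C]. The invariants
    b, add and non are of the first kind; d, cov and cof are of the second. *)
Definition unbounded_size T U (D : set T) (C : set U) (R : T -> U -> Prop) :=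
  least_size [set A : set T |
    A `<=` D /\ forall c, C c -> exists2 a, A a & ~ R a c].

Definition dominating_size T U (D : set T) (C : set U) (R : T -> U -> Prop) :=
  least_size [set A : set U |
    A `<=` C /\ forall a, D a -> exists2 c, A c & R a c].

(** A morphism of relational systems: challenges go forward along [f], responses come back along
    [g]. Thus unbounded families are carried forward and dominating families backward. *)
Definition tukey T U (D : set T) (C : set U) R T' U' (D' : set T') (C' : set U') R' :=
  exists (f : T -> T') (g : U' -> U),
    [/\ forall a, D a -> D' (f a), forall c, C' c -> C (g c) &
        forall a c, D a -> C' c -> R' (f a) c -> R a (g c)].

Section Tukey.
Variables (T U : Type) (D : set T) (C : set U) (R : T -> U -> Prop).
Variables (T' U' : Type) (D' : set T') (C' : set U') (R' : T' -> U' -> Prop).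
Hypothesis tuk : tukey D C R D' C' R'.

Lemma tukey_unbounded :
  unbounded_size D' C' R' <=c unbounded_size D C R.
Proof.
have [f [g [fD gC fg]]] := tuk.
rewrite [X in _ <=c X]/unbounded_size; case: least_sizeP => [A [AD Aunb]|]; last first.
  exact: xcard_le_Infty.
apply: xcard_le_trans (xcard_image_le f A).
apply: least_size_le; split=> [_ [a /AD Da <-]|c C'c]; first exact: fD.
have [a Aa nR] := Aunb _ (gC _ C'c); exists (f a); first by exists a.
by move=> /fg; apply: contra_not nR; apply=> //; exact: AD.
Qed.

Lemma tukey_dominating :
  dominating_size D C R <=c dominating_size D' C' R'.
Proof.
have [f [g [fD gC fg]]] := tuk.
rewrite [X in _ <=c X]/dominating_size; case: least_sizeP => [A [AC Adom]|]; last first.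
  exact: xcard_le_Infty.
apply: xcard_le_trans (xcard_image_le g A).
apply: least_size_le; split=> [_ [c /AC Cc <-]|a Da]; first exact: gC.
have [c Ac R'c] := Adom _ (fD _ Da); exists (g c); first by exists c.
by apply: fg => //; exact: AC.
Qed.

End Tukey.

(** * The bounding and dominating numbers *)

Lemma boundingE : bounding =
  unbounded_size [set: nat -> nat] [set: nat -> nat] eventually_leq.
Proof.
congr least_size; apply/seteqP; split=> F /=.
  move=> nF; split=> // g _; apply: contrapT => ng; apply: nF; exists g => f Ff.
  by apply: contrapT => nfg; apply: ng; exists f.
by move=> [_ Funb] [g gF]; have [f /gF] := Funb g I.
Qed.

Lemma dominatingE : dominating =
  dominating_size [set: nat -> nat] [set: nat -> nat] eventually_leq.
Proof.
congr least_size; apply/seteqP; split=> F /=.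
  by move=> Fdom; split=> // g _; exact: Fdom.
by move=> [_ Fdom] g; exact: Fdom.
Qed.

Lemma sequence_bounded (u : nat -> nat -> nat) : exists g, forall i, u i <=* g.
Proof.
exists (fun n => \max_(i < n.+1) u i n) => i.
apply/near_ooP; exists i => n; rewrite -ltnS => lt_in.
exact: (leq_bigmax (F := fun i : 'I_n.+1 => u i n) (Ordinal lt_in)).
Qed.

(** A countable family is bounded by the diagonal maximum of [sequence_bounded]. This supplies the
    infinite factor for [xcard_max_setX]. *)
Lemma unbounded_infinite (F : set (nat -> nat)) :
  (~ exists g, forall f, F f -> f <=* g) -> infinite_set F.
Proof.
move=> Funb /finite_set_countable.
move=> /(card_le_ex_injective 0)[c [_ c_inj]]; apply: Funb.
have /choice[u uP] i : exists v, forall f, F f -> c f = i -> v = f.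
  have [[f [Ff <-]]|nf] := pselect (exists f, F f /\ c f = i).
    by exists f => f' Ff' /c_inj->.
  by exists id => f Ff cf; case: nf; exists f.
have [g gP] := sequence_bounded u.
by exists g => f Ff; rewrite -(uP (c f) f).
Qed.

(** A dominating family is unbounded: a bound [g] fails for a member dominating the successor of
    [g]. *)
Lemma dominating_infinite (F : set (nat -> nat)) :
  (forall g, exists2 f, F f & g <=* f) -> infinite_set F.
Proof.
move=> Fdom; apply: unbounded_infinite => -[g gF].
have [f /gF/near_ooP[N Nf] /near_ooP[M Mg]] := Fdom (fun n => (g n).+1).
have := Nf (maxn N M) (leq_maxl _ _); rewrite leqNgt.
by rewrite (Mg (maxn N M)) ?leq_maxr.
Qed.

(* The functions eventually following [h] along their initial segments lie in
   countably many finitely branching trees. *)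
Lemma branches_bounded (h : seq nat -> nat) : exists g, forall f,
  (\forall n \near \oo, f n <= h (mkseq f n))%N -> f <=* g.
Proof.
(* Only finitely many sequences of length [n] have all values at most [b]; they are indexed by
   tuples over ['I_b.+1]. *)
have lvl b n : exists c, forall f, (forall i, i < n -> f i <= b)%N ->
    (h (mkseq f n) <= c)%N.
  exists (\max_(t : n.-tuple 'I_b.+1) h (map val t)) => f fb.
  pose t := [tuple (inord (f i) : 'I_b.+1) | i < n].
  have -> : mkseq f n = map val t.
    apply: (@eq_from_nth _ 0); first by rewrite size_mkseq size_map size_tuple.
    move=> i; rewrite size_mkseq => lt_in.
    rewrite nth_mkseq // (nth_map ord0) ?size_tuple //.
    rewrite -[i]/(val (Ordinal lt_in)) -tnth_nth tnth_mktuple /=.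
    by rewrite inordK // ltnS fb.
  exact: (leq_bigmax (F := fun t : n.-tuple 'I_b.+1 => h (map val t))).
(* Induction on the level: a bound on the values below [n] leaves finitely many nodes, and these
   bound the value at [n]. *)
have tree m n : exists b, forall f,
    (forall i, f i <= maxn m (h (mkseq f i)))%N -> (forall i, i < n -> f i <= b)%N.
  elim: n => [|n [b bP]]; first by exists 0.
  have [c cP] := lvl b n; exists (maxn b (maxn m c)) => f fh i.
  rewrite ltnS leq_eqVlt => /orP[/eqP->|lt_in].
    apply: leq_trans (fh n) _; rewrite geq_max; apply/andP; split.
      by rewrite !leq_max leqnn orbT.
    rewrite !leq_max; apply/orP; right; apply/orP; right.
    exact/cP/bP.
  by rewrite leq_max (bP f fh _ lt_in).
have /choice[b bP] : forall p : nat * nat, exists b, forall f,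
    (forall i, f i <= maxn p.1 (h (mkseq f i)))%N ->
    (forall i, i < p.2 -> f i <= b)%N by move=> p; exact: tree.
have [g gP] := sequence_bounded (fun m n => b (m, n.+1)).
exists g => f /near_ooP[N Nf].
(* Absorbing the values before [N] into [m] makes [f] a branch of the tree of index [m] from its
   root on. *)
pose m := \max_(i < N) f i.
have /near_ooP[M Mg] := gP m.
apply/near_ooP; exists M => n /Mg; apply: leq_trans.
apply: (bP (m, n.+1) f) => //= i; rewrite leq_max.
have [/Nf->|lt_iN] := leqP N i; first by rewrite orbT.
by rewrite (leq_bigmax (F := fun i : 'I_N => f i) (Ordinal lt_iN)).
Qed.

Lemma sub_almost_subset X (A B : set X) : A `<=` B -> A `<=*` B.
Proof.
move=> AB; rewrite /almost_subset (_ : A `\` B = set0); first exact: finite_set0.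
by rewrite setD_eq0.
Qed.

(** * The ideals M_I and K_I *)

Lemma finite_nat_bounded (A : set nat) : finite_set A ->
  exists k, forall n, A n -> (n <= k)%N.
Proof.
move=> /finite_seqP[s ->]; exists (\max_(i <- s) i) => n sn.
exact: leq_bigmax_seq.
Qed.

Lemma injective_eventually_geq (f : nat -> nat) N : injective f ->
  \forall n \near \oo, (N <= f n)%N.
Proof.
move=> f_inj; have : finite_set (f @^-1` `I_N).
  by apply: finite_preimage (finite_II N) => m n _ _ /f_inj.
move=> /finite_nat_bounded[k kP]; apply/near_ooP; exists k.+1 => n.
by apply: contraTT; rewrite -ltnNge -leqNgt => /kP.
Qed.

(** By downward closure, a union belongs to [J] exactly when its pieces have a common upper bound in
    [J]. *)
Lemma add_unboundedE Y (J : set (set Y)) :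
  (forall A B, A `<=` B -> J B -> J A) -> add J = unbounded_size J J subset.
Proof.
move=> Jsub; congr least_size; apply/seteqP; split=> A /= [AJ Aunb]; split=> //.
  move=> C JC; apply: contrapT => nA; apply: Aunb; apply: Jsub JC.
  move=> x [B AB Bx]; have [BC|nBC] := pselect (B `<=` C); first exact: BC.
  by case: nA; exists B.
move=> /Aunb[B AB]; apply; exact: bigcup_sup.
Qed.

Lemma non_unboundedE Y (J : set (set Y)) :
  (forall A B, A `<=` B -> J B -> J A) ->
  non J = unbounded_size [set: Y] J (fun x A => A x).
Proof.
move=> Jsub; congr least_size; apply/seteqP; split=> A /=.
  move=> nJA; split=> // B JB; apply: contrapT => nAB; apply/nJA/(Jsub _ B) => // x Ax.
  by apply: contrapT => nBx; apply: nAB; exists x.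
by move=> [_ Aunb] /Aunb[x Ax]; apply.
Qed.

Lemma cov_dominatingE Y (J : set (set Y)) :
  cov J = dominating_size [set: Y] J (fun x A => A x).
Proof.
congr least_size; apply/seteqP; split=> A /= [AJ Acov]; split=> //.
  by move=> x _; have : [set: Y] x by []; rewrite -Acov => -[B]; exists B.
by rewrite -subTset => x _; have [B AB Bx] := Acov x I; exists B.
Qed.

Lemma tukey_sub_ideal Y (J K : set (set Y)) : J `<=` K ->
  tukey [set: Y] K (fun x A => A x) [set: Y] J (fun x A => A x).
Proof. by move=> JK; exists id, id. Qed.

Lemma add_star_omegaE X (I : set (set X)) :
  add_star_omega I = unbounded_size I (omega_subsets I)
    (fun A Bs => exists2 B, Bs B & A `<=*` B).
Proof.
congr least_size; apply/seteqP; split=> A /= [AI Aunb]; split=> // Bs /Aunb[C AC nC].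
  by exists C => // -[B /nC].
by exists C => // B BsB CB; apply: nC; exists B.
Qed.

(** * An ideal on a set enumerated by [d] *)

Section IdealInvariants.
Variables (X : Type) (I : set (set X)) (e : X -> nat) (d : nat -> X).
Hypotheses (I_ideal : ideal I) (eK : cancel e d) (dK : cancel d e).

(** Numbering the finite sequences lets the generators of M_I be indexed by I^omega, like those of
    K_I. *)
Let code (s : seq X) : nat := pickle (map e s).
Let decode (n : nat) : seq X := map d (odflt [::] (unpickle n)).

Let codeK : cancel code decode.
Proof. by move=> s; rewrite /decode pickleK /= mapK. Qed.

Let code_inj : injective code := can_inj codeK.

Lemma ideal_sub A B : A `<=` B -> I B -> I A.
Proof. by have [+ _ _ _] := I_ideal; apply. Qed.

Lemma ideal_finite A : finite_set A -> I A.
Proof. by have [_ _ _] := I_ideal; apply. Qed.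

Lemma ideal_setU A B : I A -> I B -> I (A `|` B).
Proof. by have [_ + _ _] := I_ideal; apply. Qed.

Lemma ideal_bigcup (phi : nat -> set X) n :
  (forall i, I (phi i)) -> I (\bigcup_(i in [set i | i <= n]%N) phi i).
Proof.
move=> Iphi; elim: n => [|n IHn].
  by apply: ideal_sub (Iphi 0) => x [i]; rewrite /= leqn0 => /eqP->.
apply: ideal_sub (ideal_setU IHn (Iphi n.+1)) => x [i].
by rewrite /= leq_eqVlt => /orP[/eqP->|lt_in] phix; [right|left; exists i].
Qed.

Lemma initial_finite n : finite_set [set x | e x <= n]%N.
Proof.
apply: sub_finite_set (finite_image d (finite_II n.+1)) => x /= le_xn.
by exists (e x) => //=; rewrite eK.
Qed.

Lemma finite_initial (A : set X) : finite_set A ->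
  exists n, forall x, A x -> (e x <= n)%N.
Proof.
move=> /(finite_image e)/finite_nat_bounded[n nP].
by exists n => x Ax; apply: nP; exists x.
Qed.

Lemma infinite_enum (A : set X) : A #= [set: nat] ->
  exists2 u : nat -> X, (forall n, A (u n)) & injective u.
Proof.
move=> /card_eqPle[_ leA]; apply: (card_le_fun_nat (d 0)).
exact/infiniteP.
Qed.

Lemma enum_finite (A : set X) (u : nat -> X) : injective u ->
  finite_set (A `&` range u) -> exists k, forall n, A (u n) -> (n <= k)%N.
Proof.
move=> u_inj Afin.
have : finite_set (u @^-1` (A `&` range u)).
  by apply: finite_preimage Afin => m n _ _ /u_inj.
move=> /finite_nat_bounded[k kP]; exists k => n Aun.
by apply: kP; split.
Qed.

(** The range of [phi] may be finite; adding all singletons makes the family infinite without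
    leaving [I]. *)
Lemma omega_subsets_range (phi : nat -> set X) : (forall n, I (phi n)) ->
  exists2 Bs, omega_subsets I Bs & forall n, Bs (phi n).
Proof.
move=> Iphi; pose psi (i : nat + nat) :=
  match i with inl n => phi n | inr n => [set d n] end.
exists (range psi) => [|n]; last by exists (inl n).
split=> [_ [[n|n] _ <-] /=|]; [exact: Iphi|exact/ideal_finite/finite_set1|].
apply: eq_card_nat.
  exact: card_le_trans (card_image_le _ _) (countableP _).
apply/infiniteP.
apply: (@card_le_injective _ _ _ _ (fun n => [set d n])) => [n _|m n _ _ mn].
  by exists (inr n).
apply: (can_inj dK); have : [set d m] (d m) by [].
by rewrite mn.
Qed.

(** Passing to an increasing sequence reduces almost inclusion in some member of [Bs] to a single
    index, and larger indices work as well. *)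
Lemma omega_subsets_enum Bs : omega_subsets I Bs ->
  exists C : nat -> set X, [/\ forall j, I (C j),
    forall i j, (i <= j)%N -> C i `<=` C j &
    forall A B, Bs B -> A `<=*` B -> exists j, A `<=` C j].
Proof.
move=> [BsI /card_eqPle[/(card_le_ex_injective 0)[c [_ c_inj]] _]].
have /choice[v vP] k : exists B, I B /\ forall B', Bs B' -> c B' = k -> B = B'.
  have [[B [BsB <-]]|nB] := pselect (exists B, Bs B /\ c B = k).
    by exists B; split=> [|B' BsB' /c_inj->//]; exact: BsI.
  exists set0; split=> [|B BsB cB]; first exact: ideal_finite.
  by case: nB; exists B.
(* Adding larger and larger finite sets turns almost inclusion in a member of
   [Bs] into inclusion in some [C j]. *)
exists (fun j => \bigcup_(i in [set i | i <= j]%N) v i `|` [set x | e x <= j]%N).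
split=> [j|i j le_ij x [[k /= le_ki vx]|/= le_xi]|A B BsB AB].
- apply: ideal_setU; last exact/ideal_finite/initial_finite.
  by apply: ideal_bigcup => i; have [] := vP i.
- by left; exists k => //=; exact: leq_trans le_ij.
- by right; exact: leq_trans le_ij.
have [n nP] := finite_initial AB.
exists (maxn (c B) n) => x Ax; have [Bx|nBx] := pselect (B x); [left|right].
  exists (c B) => /=; first exact: leq_maxl.
  by have [_ /(_ _ BsB erefl)->] := vP (c B).
by apply: leq_trans (leq_maxr _ _); apply: nP.
Qed.

(** * The order I^omega and the sets contained in one generator *)

Definition ideal_seq : set (nat -> set X) := [set phi | forall n, I (phi n)].

Definition eventually_sub (phi psi : nat -> set X) : Prop :=
  \forall n \near \oo, phi n `<=` psi n.

(** Countable unions are absorbed by a diagonal: the union of the [phi i n] over [i <= n] eventually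
    contains each [phi i]. *)
Lemma smallest_sigma_ideal_eq Y (S : (nat -> set X) -> set Y) :
  (forall phi psi, eventually_sub phi psi -> S phi `<=` S psi) ->
  smallest (@sigma_ideal Y) [set S phi | phi in ideal_seq] =
  [set A | exists2 phi, ideal_seq phi & A `<=` S phi].
Proof.
move=> Smono; apply/seteqP; split=> [A|A [phi Iphi Aphi]]; last first.
  by move=> J [[_ Jsub _] SJ]; apply: Jsub Aphi _; apply: SJ; exists phi.
apply; split=> [|_ [phi Iphi <-]]; last by exists phi.
split=> [|A' B AB [phi Iphi Bphi]|F FS].
- by exists (fun=> set0) => // n; exact: ideal_finite.
- by exists phi => //; exact: subset_trans Bphi.
have /choice[phi phiP] n : exists phi, ideal_seq phi /\ F n `<=` S phi.
  by have [phi] := FS n; exists phi.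
exists (fun n => \bigcup_(i in [set i | i <= n]%N) phi i n).
  by move=> n; apply: ideal_bigcup => i; have [] := phiP i.
move=> x [n _ Fx]; have [_ /(_ _ Fx)] := phiP n; apply: Smono.
by apply/near_ooP; exists n => m le_nm z phiz; exists n.
Qed.

Lemma K_set_sub phi psi : eventually_sub phi psi -> K_set phi `<=` K_set psi.
Proof.
move=> /near_ooP[N Nsub] x /near_ooP[M Mphi]; apply/near_ooP.
by exists (maxn N M) => n; rewrite geq_max => /andP[/Nsub+ /Mphi]; apply.
Qed.

Let M_seq_set (phi : nat -> set X) := M_set (phi \o code).

Let mkseq_inj (x : nat -> X) : injective (mkseq x).
Proof. by move=> m n /(congr1 size); rewrite !size_mkseq. Qed.

(** The initial segments of a branch have distinct codes, so these codes tend to infinity and reach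
    the range where the inclusion holds. *)
Lemma M_seq_set_sub phi psi :
  eventually_sub phi psi -> M_seq_set phi `<=` M_seq_set psi.
Proof.
move=> /near_ooP[N Nsub] x /near_ooP[M Mphi]; apply/near_ooP.
have /near_ooP[L Lcode] := injective_eventually_geq N
  (inj_comp code_inj (@mkseq_inj x)).
exists (maxn L M) => n; rewrite geq_max => /andP[/Lcode/Nsub+ /Mphi]; exact.
Qed.

Lemma K_idealE :
  K_ideal I = [set A | exists2 phi, ideal_seq phi & A `<=` K_set phi].
Proof. exact/smallest_sigma_ideal_eq/K_set_sub. Qed.

Lemma M_idealE :
  M_ideal I = [set A | exists2 phi, ideal_seq phi & A `<=` M_seq_set phi].
Proof.
rewrite -(smallest_sigma_ideal_eq M_seq_set_sub); congr smallest.
apply/seteqP; split=> _ [phi Iphi <-]; last first.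
  by exists (phi \o code) => // s; exact: Iphi.
exists (phi \o decode) => [n|]; first exact: Iphi.
by rewrite /M_seq_set; congr M_set; apply/funext => s /=; rewrite codeK.
Qed.

Lemma K_ideal_sub_M_ideal : K_ideal I `<=` M_ideal I.
Proof.
rewrite K_idealE M_idealE => A [phi Iphi Aphi].
exists (fun n => phi (size (decode n))) => // x /Aphi/near_ooP[N Nphi].
by apply/near_ooP; exists N => n /Nphi /=; rewrite codeK size_mkseq.
Qed.

(** Letting [J] range between the two ideals treats both at once: the challenge is always a
    K-generator, while the response only uses a covering M-generator. *)
Lemma ideal_seq_tukey (J : set (set (nat -> X))) :
  K_ideal I `<=` J -> J `<=` M_ideal I ->
  tukey ideal_seq ideal_seq eventually_sub J J subset.
Proof.
rewrite K_idealE M_idealE => KJ JM.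
have /choice[g gP] B : exists psi, J B -> ideal_seq psi /\ B `<=` M_seq_set psi.
  by have [/JM[psi]|nJB] := pselect (J B); [exists psi|exists (fun=> set0)].
pose pad s n := s ++ nseq (n - size s) (d 0).
(* Adding [d 0] to every value lets a branch fall back on this point and remain in the generator. *)
exists (fun phi => K_set (fun n => phi n `|` [set d 0])).
(* The sequence where the padding starts depends on [phi], which the response does not see; hence
   the union over all codes up to [n]. *)
exists (fun B n => \bigcup_(i in [set i | i <= n]%N) g B (code (pad (decode i) n))).
split=> [phi Iphi|B /gP[Ig _]|phi B Iphi JB phiB].
- apply: KJ; exists (fun n => phi n `|` [set d 0]) => // n.
  by apply: ideal_setU => //; exact/ideal_finite/finite_set1.
- by move=> n; apply: (ideal_bigcup (phi := fun i => g B (code (pad (decode i) n)))).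
have [_ Bg] := gP _ JB.
(* The branch [x] leaves [g B] whenever [phi] allows it and takes the value
   [d 0] otherwise. *)
have /choice[y yP] t : exists y,
    (phi (size t) `|` [set d 0]) y /\
    (phi (size t) `<=` g B (code t) /\ y = d 0 \/ ~ g B (code t) y).
  have [sub|nsub] := pselect (phi (size t) `<=` g B (code t)).
    by exists (d 0); split; [right|left].
  have [y [phiy ny]] : exists y, phi (size t) y /\ ~ g B (code t) y.
    apply: contrapT => nex; apply: nsub => y phiy; apply: contrapT => ny.
    by apply: nex; exists y.
  by exists y; split; [left|right].
pose xs n := iter n (fun t => rcons t (y t)) [::].
pose x n := y (xs n).
have xsE n : mkseq x n = xs n by elim: n => // n IHn; rewrite mkseqS IHn.
have sxs n : size (xs n) = n by rewrite -xsE size_mkseq.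
have /phiB/Bg/near_ooP[N Ng] : K_set (fun n => phi n `|` [set d 0]) x.
  by apply/near_ooP; exists 0 => n _; have [] := yP (xs n); rewrite sxs.
(* From [N] on, [x] stays in [g B], so the escaping alternative of [yP] is excluded. *)
have x0 n : (N <= n)%N -> phi n `<=` g B (code (xs n)) /\ x n = d 0.
  move=> /Ng /=; rewrite xsE => gx.
  by have [_ [[]|]] := yP (xs n); rewrite ?sxs.
have xs_pad n : (N <= n)%N -> xs n = pad (xs N) n.
  rewrite /pad sxs => le_Nn; rewrite -{1}(subnKC le_Nn).
  elim: (n - N) => [|m IHm]; first by rewrite addn0 cats0.
  rewrite addnS [LHS]/= -/(x _) IHm; have [_ ->] := x0 (N + m) (leq_addr _ _).
  by rewrite -cats1 -catA -addn1 nseqD.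
(* Past [code (xs N)], the paddings of [xs N] take part in the union. *)
apply/near_ooP; exists (maxn N (code (xs N))) => n.
rewrite geq_max => /andP[le_Nn le_cn] z /(x0 n le_Nn).1 gz.
by exists (code (xs N)) => //; rewrite codeK -xs_pad.
Qed.

(** * Further Tukey connections with I^omega and omega^omega *)

Lemma generated_tukey_ideal_seq Y (S : (nat -> set X) -> set Y) J :
  (forall phi psi, eventually_sub phi psi -> S phi `<=` S psi) ->
  J = [set A | exists2 phi, ideal_seq phi & A `<=` S phi] ->
  tukey J J subset ideal_seq ideal_seq eventually_sub.
Proof.
move=> Smono ->.
have /choice[g gP] A : exists phi,
    (exists2 phi, ideal_seq phi & A `<=` S phi) -> ideal_seq phi /\ A `<=` S phi.
  have [[phi Iphi Aphi]|nA] := pselect (exists2 phi, ideal_seq phi & A `<=` S phi).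
    by exists phi.
  by exists (fun=> set0) => /nA.
exists g, S; split=> [A /gP[] //|phi Iphi|A phi /gP[_ Ag] Iphi gphi].
  by exists phi.
exact: subset_trans (Smono _ _ gphi).
Qed.

(** A function becomes a sequence of initial segments of the enumeration. Since [X] is not in the
    ideal, [psi n] misses some [d (g n)], and an initial segment contained in [psi n] stops before
    it. *)
Lemma eventually_leq_tukey_ideal_seq :
  tukey [set: nat -> nat] [set: nat -> nat] eventually_leq
    ideal_seq ideal_seq eventually_sub.
Proof.
have /choice[g gP] (psi : nat -> set X) : exists g : nat -> nat,
    ideal_seq psi -> forall n, ~ psi n (d (g n)).
  have [Ipsi|nI] := pselect (ideal_seq psi); last by exists id => /nI.
  suff /choice[g gP] n : exists k, ~ psi n (d k) by exists g.
  apply: contrapT => npsi; have [_ _ + _] := I_ideal; apply.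
  apply: ideal_sub (Ipsi n) => x _; apply: contrapT => nx.
  by apply: npsi; exists (e x); rewrite eK.
exists (fun f n => [set x | e x <= f n]%N), g; split=> // [f _ n|f psi _ /gP ng].
  exact/ideal_finite/initial_finite.
move=> /near_ooP[N Nf]; apply/near_ooP; exists N => n /Nf sub.
rewrite leqNgt; apply/negP => lt_gf; apply: (ng n); apply: sub.
by rewrite /= dK ltnW.
Qed.

(** Initial segments of the enumeration are finite, so sets bounded in omega^omega lie in K_I. *)
Lemma eventually_leq_tukey_K :
  tukey [set: nat -> X] (K_ideal I) (fun x A => A x)
    [set: nat -> nat] [set: nat -> nat] eventually_leq.
Proof.
exists (fun x n => e (x n)), (fun g => K_set (fun n => [set x | e x <= g n]%N)).
split=> // g _; rewrite K_idealE; exists (fun n => [set x | e x <= g n]%N) => // n.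
exact/ideal_finite/initial_finite.
Qed.

(** Through constant sequences, an eventual inclusion yields an inclusion at a single index. *)
Lemma add_star_tukey :
  tukey I (omega_subsets I) (fun A Bs => exists2 B, Bs B & A `<=*` B)
    ideal_seq ideal_seq eventually_sub.
Proof.
have /choice[g gP] psi : exists Bs, ideal_seq psi ->
    omega_subsets I Bs /\ forall n, Bs (psi n).
  have [/omega_subsets_range[Bs]|nI] := pselect (ideal_seq psi); first by exists Bs.
  by exists set0 => /nI.
exists (fun A _ => A), g; split=> [A IA n //|psi /gP[] //|A psi _ /gP[_ gpsi]].
move=> /near_ooP[N /(_ _ (leqnn N)) Apsi]; exists (psi N) => //.
exact: sub_almost_subset.
Qed.

(** The challenge is the increasing sequence attached to [Bs]: each member of [Bs] lies in almost
    all of its terms, hence in some term of any bound. *)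
Lemma cof_star_tukey :
  tukey (omega_subsets I) (omega_subsets I)
    (fun Bs As => forall B, Bs B -> exists2 C, As C & B `<=*` C)
    ideal_seq ideal_seq eventually_sub.
Proof.
have /choice[g gP] psi : exists Bs, ideal_seq psi ->
    omega_subsets I Bs /\ forall n, Bs (psi n).
  have [/omega_subsets_range[Bs]|nI] := pselect (ideal_seq psi); first by exists Bs.
  by exists set0 => /nI.
have /choice[f fP] Bs : exists phi, omega_subsets I Bs -> ideal_seq phi /\
    forall B, Bs B -> exists j, forall n, (j <= n)%N -> B `<=` phi n.
  have [oBs|nI] := pselect (omega_subsets I Bs); last by exists (fun=> set0) => /nI.
  have [C [IC Cmono BC]] := omega_subsets_enum oBs.
  exists C => _; split=> // B BsB.
  have [|j Bj] := BC B B BsB; first exact: sub_almost_subset.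
  by exists j => n /Cmono; exact: subset_trans.
exists f, g; split=> [Bs /fP[] //|psi /gP[] //|Bs psi /fP[_ fB] /gP[_ gpsi]].
move=> /near_ooP[N Nsub] B /fB[j Bj]; exists (psi (maxn N j)) => //.
apply: sub_almost_subset.
exact: subset_trans (Bj _ (leq_maxr _ _)) (Nsub _ (leq_maxl _ _)).
Qed.

(** * The two-step bounds *)

Lemma min_le_unbounded_ideal_seq :
  xcard_min bounding (add_star_omega I) <=c
  unbounded_size ideal_seq ideal_seq eventually_sub.
Proof.
rewrite [X in _ <=c X]/unbounded_size; case: least_sizeP => [F [IF Funb]|]; last first.
  exact: xcard_le_Infty.
apply: xcard_min_le.
(* If [F] is too small for the star invariant, its values at each [n] are trapped in one increasing
   sequence [C n]. The index functions are then unbounded, since a bound [g] would make [C n (g n)]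
   a bound of [F]. *)
have [leF|nle] := pselect (add_star_omega I <=c Size F); [by right|left].
have /choice[C CP] n : exists C : nat -> set X, [/\ forall j, I (C j),
    forall i j, (i <= j)%N -> C i `<=` C j &
    forall phi, F phi -> exists j, phi n `<=` C j].
  have [Bs [oBs BsP]] : exists Bs, omega_subsets I Bs /\
      forall phi, F phi -> exists2 B, Bs B & phi n `<=*` B.
    apply: contrapT => nBs; apply: nle.
    apply: xcard_le_trans (xcard_image_le (fun phi => phi n) F).
    apply: least_size_le; split=> [_ [phi /IF Iphi <-]|Bs oBs]; first exact: Iphi.
    apply: contrapT => nphi; apply: nBs; exists Bs; split=> // phi Fphi.
    apply: contrapT => nB; apply: nphi; exists (phi n); first by exists phi.
    by move=> B BsB phiB; apply: nB; exists B.
  have [C [IC Cmono BC]] := omega_subsets_enum oBs.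
  exists C; split=> // phi /BsP[B BsB]; exact: BC.
have /choice[h hP] phi : exists h : nat -> nat, F phi -> forall n, phi n `<=` C n (h n).
  have [Fphi|nF] := pselect (F phi); last by exists id => /nF.
  suff /choice[h hP] n : exists j, phi n `<=` C n j by exists h.
  by have [_ _] := CP n; apply.
apply: xcard_le_trans (xcard_image_le h F).
apply: least_size_le => /= -[g gP].
have [n|phi Fphi] := Funb (fun n => C n (g n)); first by have [] := CP n.
apply; have /near_ooP[N Ng] := gP _ (ex_intro2 _ _ _ Fphi erefl).
apply/near_ooP; exists N => n /Ng; have [_ Cmono _] := CP n.
by move=> /Cmono; apply: subset_trans; exact: hP.
Qed.

(** A cofinal [A] provides the trapping sequences and a dominating [D] the indices; the pairs form a
    dominating family. *)
Lemma dominating_ideal_seq_le_max :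
  dominating_size ideal_seq ideal_seq eventually_sub <=c
  xcard_max dominating (cof_star_omega I).
Proof.
rewrite /dominating; case: least_sizeP => [D Ddom|]; last first.
  by apply: xcard_le_trans (xcard_le_maxl _ _); exact: xcard_le_Infty.
rewrite /cof_star_omega; case: least_sizeP => [A [AI Adom]|]; last first.
  by apply: xcard_le_trans (xcard_le_maxr _ _); exact: xcard_le_Infty.
apply: xcard_le_trans (xcard_max_setX _ (dominating_infinite Ddom)).
have /choice[C CP] Bs : exists C : nat -> set X, A Bs -> [/\ forall j, I (C j),
    forall i j, (i <= j)%N -> C i `<=` C j &
    forall A B, Bs B -> A `<=*` B -> exists j, A `<=` C j].
  have [/AI/omega_subsets_enum[C CP]|nA] := pselect (A Bs); first by exists C.
  by exists (fun=> set0) => /nA.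
pose G (p : (nat -> nat) * set (set X)) n := C p.2 (p.1 n).
apply: xcard_le_trans (xcard_image_le G (D `*` A)).
apply: least_size_le; split=> [_ [[g Bs] [_ /CP[IC _ _]] <-] n|phi Iphi].
  exact: IC.
have [Bs oBs Bsphi] := omega_subsets_range Iphi.
have [As AAs AsP] := Adom _ oBs; have [_ Cmono CAs] := CP _ AAs.
have /choice[h hP] n : exists j, phi n `<=` C As j.
  by have [B] := AsP _ (Bsphi n); exact: CAs.
have [g Dg /near_ooP[N Ng]] := Ddom h.
exists (G (g, As)); first by exists (g, As).
by apply/near_ooP; exists N => n /Ng/Cmono; exact: subset_trans.
Qed.

Lemma non_M_ideal_le_max :
  non (M_ideal I) <=c xcard_max bounding (non_star_omega I).
Proof.
rewrite /bounding; case: least_sizeP => [F Funb|]; last first.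
  by apply: xcard_le_trans (xcard_le_maxl _ _); exact: xcard_le_Infty.
rewrite /non_star_omega; case: least_sizeP => [A [AX Anon]|]; last first.
  by apply: xcard_le_trans (xcard_le_maxr _ _); exact: xcard_le_Infty.
apply: xcard_le_trans (xcard_max_setX _ (unbounded_infinite Funb)).
have /choice[u uP] B : exists u : nat -> X, A B ->
    (forall n, B (u n)) /\ injective u.
  have [/AX[_ /infinite_enum[u uB u_inj]]|nA] := pselect (A B); first by exists u.
  by exists d => /nA.
(* Each [f] is copied into [B] along its enumeration. If one [phi] captured all copies, a [B] almost
   disjoint from its values would make [F] bounded. *)
pose G (p : (nat -> nat) * set X) n := u p.2 (p.1 n).
apply: xcard_le_trans (xcard_image_le G (F `*` A)).
apply: least_size_le => /=; rewrite M_idealE => -[phi Iphi Gphi].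
have [Bs oBs Bsphi] := omega_subsets_range Iphi.
have [B AB BBs] := Anon _ oBs; have [uB u_inj] := uP _ AB.
have /choice[h hP] m : exists k, forall n, phi m (u B n) -> (n <= k)%N.
  apply: enum_finite => //; apply: sub_finite_set (BBs _ (Bsphi m)).
  by move=> y [phiy [n _ uy]]; split; rewrite -?uy // uy.
have [g gP] := branches_bounded (fun t => h (code (map (u B) t))).
apply: Funb; exists g => f Ff; apply: gP.
have /Gphi/near_ooP[N Nphi] : (G @` (F `*` A)) (G (f, B)) by exists (f, B).
apply/near_ooP; exists N => n /Nphi /= /hP.
by rewrite /mkseq -map_comp.
Qed.

Lemma min_le_cov_M_ideal :
  xcard_min dominating (cov_star I) <=c cov (M_ideal I).
Proof.
rewrite [X in _ <=c X]/cov; case: least_sizeP => [A [AM Acov]|]; last first.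
  exact: xcard_le_Infty.
apply: xcard_min_le.
have [leA|nle] := pselect (cov_star I <=c Size A); [by right|left].
(* As [A] is too small for [cov_star], at each code [m] some infinite set, enumerated by [u m],
   meets every [Phi B m] in a finite set. The branches through these sets are indexed by
   omega^omega, and each member of [A] captures only a bounded set of indices. *)
have /choice[Phi PhiP] B : exists phi, A B -> ideal_seq phi /\ B `<=` M_seq_set phi.
  have [/AM|nA] := pselect (A B); last by exists (fun=> set0) => /nA.
  by rewrite M_idealE => -[phi]; exists phi.
have /choice[u uP] m : exists u : nat -> X, forall B, A B ->
    exists k, forall n, Phi B m (u n) -> (n <= k)%N.
  have [C [[_ /infinite_enum[u uC u_inj]] CP]] : exists C,
      omega_subsets [set: X] C /\ forall B, A B -> finite_set (Phi B m `&` C).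
    apply: contrapT => nC; apply: nle.
    apply: xcard_le_trans (xcard_image_le (fun B => Phi B m) A).
    apply: least_size_le; split=> [_ [B /PhiP[IB _] <-] //|C oC].
    apply: contrapT => nB; apply: nC; exists C; split=> // B AB.
    apply: contrapT => inf; apply: nB; exists (Phi B m); first by exists B.
    apply: eq_card_nat inf; apply: card_le_trans (countableP [set: nat]).
    by apply: (@card_le_injective _ _ _ _ e) => // x y _ _; exact: (can_inj eK).
  exists u => B /CP fin; apply: enum_finite => //; apply: sub_finite_set fin.
  by move=> y [phiy [n _ uy]]; split; rewrite -?uy // uy.
have /choice[h hP] B : exists h : nat -> nat, A B ->
    forall m n, Phi B m (u m n) -> (n <= h m)%N.
  have [AB|nA] := pselect (A B); last by exists id => /nA.
  suff /choice[h hP] m : exists k, forall n, Phi B m (u m n) -> (n <= k)%N.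
    by exists h.
  exact: uP.
(* [trace t] is the sequence whose successive values are the points of the sets
   enumerated by [u] with indices given by [t]. *)
pose trace t := foldl (fun s n => rcons s (u (code s) n)) [::] t.
have /choice[g gP] B := branches_bounded (fun t => h B (code (trace t))).
apply: xcard_le_trans (xcard_image_le g A).
apply: least_size_le => /= f.
(* The branch with indices [f]; a member of [A] containing it gives a function dominating [f]. *)
pose x n := u (code (trace (mkseq f n))) (f n).
have xE n : mkseq x n = trace (mkseq f n).
  by elim: n => // n IHn; rewrite !mkseqS /trace foldl_rcons IHn.
have : [set: nat -> X] x by [].
rewrite -Acov => -[B AB Bx]; exists (g B); first by exists B.
have [_ /(_ _ Bx)/near_ooP[N Nphi]] := PhiP _ AB.
apply: gP; apply/near_ooP; exists N => n /Nphi /=.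
by rewrite xE => /(hP _ AB).
Qed.

End IdealInvariants.

Theorem theoremA (X : Type) (X_countable : [set: X] #= [set: nat])
    (I : set (set X)) (I_ideal : ideal I) :
  [/\ (* (1) *)
      add (M_ideal I) =c add (K_ideal I) /\
      add (K_ideal I) =c xcard_min bounding (add_star_omega I),
      (* (2) *)
      [/\ bounding <=c non (K_ideal I),
          non (K_ideal I) <=c non (M_ideal I) &
          non (M_ideal I) <=c xcard_max bounding (non_star_omega I)],
      (* (3) *)
      [/\ xcard_min dominating (cov_star I) <=c cov (M_ideal I),
          cov (M_ideal I) <=c cov (K_ideal I) &
          cov (K_ideal I) <=c dominating] &
      (* (4) *)
      cof (M_ideal I) =c cof (K_ideal I) /\
      cof (K_ideal I) =c xcard_max dominating (cof_star_omega I)].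
Proof.
have /card_set_bijP[e] := X_countable; rewrite setTT_bijective => -[d eK dK].
have KM := K_ideal_sub_M_ideal I_ideal eK.
have subK (A B : set (nat -> X)) : A `<=` B -> K_ideal I B -> K_ideal I A.
  by rewrite (K_idealE I_ideal) => AB [phi Iphi Bphi]; exists phi => // x /AB/Bphi.
have subM (A B : set (nat -> X)) : A `<=` B -> M_ideal I B -> M_ideal I A.
  by rewrite (M_idealE I_ideal eK) => AB [phi Iphi Bphi]; exists phi => // x /AB/Bphi.
have tK := generated_tukey_ideal_seq (@K_set_sub X) (K_idealE I_ideal).
have tM := generated_tukey_ideal_seq (M_seq_set_sub eK) (M_idealE I_ideal eK).
have tK' := ideal_seq_tukey I_ideal eK (@subset_refl _ (K_ideal I)) KM.
have tM' := ideal_seq_tukey I_ideal eK KM (@subset_refl _ (M_ideal I)).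
have tw := eventually_leq_tukey_ideal_seq I_ideal eK dK.
have tKw := eventually_leq_tukey_K I_ideal eK.
have tKM := tukey_sub_ideal KM.
rewrite (add_unboundedE subK) (add_unboundedE subM).
rewrite (non_unboundedE subK) (non_unboundedE subM).
rewrite !cov_dominatingE.
have addK := tukey_unbounded tK; have addK' := tukey_unbounded tK'.
have addM := tukey_unbounded tM; have addM' := tukey_unbounded tM'.
have cofK := tukey_dominating tK; have cofK' := tukey_dominating tK'.
have cofM := tukey_dominating tM; have cofM' := tukey_dominating tM'.
split.
- split; apply: xcard_le_anti.
  + exact: xcard_le_trans addM' addK.
  + exact: xcard_le_trans addK' addM.
  + apply: xcard_le_trans addK' _; apply: xcard_le_min.
      by rewrite boundingE; exact: tukey_unbounded tw.
    rewrite add_star_omegaE; exact: tukey_unbounded (add_star_tukey I_ideal dK).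
  + apply: xcard_le_trans addK; exact: (min_le_unbounded_ideal_seq I_ideal eK).
- split.
  + by rewrite boundingE; exact: tukey_unbounded.
  + exact: tukey_unbounded.
  + rewrite -(non_unboundedE subM); exact: (non_M_ideal_le_max I_ideal eK dK).
- split.
  + rewrite -cov_dominatingE; exact: (min_le_cov_M_ideal I_ideal eK).
  + exact: tukey_dominating.
  + by rewrite dominatingE; exact: tukey_dominating.
- split; apply: xcard_le_anti.
  + exact: xcard_le_trans cofM cofK'.
  + exact: xcard_le_trans cofK cofM'.
  + apply: xcard_le_trans cofK _; exact: (dominating_ideal_seq_le_max I_ideal eK dK).
  + apply: xcard_le_trans cofK'; apply: xcard_max_le.
      by rewrite dominatingE; exact: tukey_dominating tw.
    exact: tukey_dominating (cof_star_tukey I_ideal eK dK).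
Qed.
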